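(* Let $k$ be a field of characteristic $0$. Let $A$ be an exact Poisson algebra over $k$ which is a complete Noetherian local ring with residue field $k$, and assume that its maximal ideal $\mathfrak{m}\subset A$ is preserved by all derivations of the algebra $A$. Then there exists an integer $l\neq0$ and a multiplicative grading $$A=\bigoplus_{p\in\mathbb{Z}}A^p$$ on the algebra $A$ (in the completed sense: $A=\varprojlim_q A/\mathfrak{m}^q$, and the grading is given by a compatible system of multiplicative $\mathbb{Z}$-gradings on the quotients $A/\mathfrak{m}^q$) such that $$\left\{A^p,A^q\right\}\subset A^{p+q-l}$$ for all $p,q\in\mathbb{Z}$.
   Context: Poisson algebra: a commutative unital $k$-algebra $A$ with a skew-symmetric $k$-bilinear bracket $\{-,-\}$ satisfying $\{a,bc\}=\{a,b\}c+\{a,c\}b$, the Jacobi identity, and $\{1,a\}=0$. A Poisson algebra $A$ is exact if there is a derivation $\xi:A\to A$ with $\xi(\{a,b\})=\{a,b\}+\{\xi(a),b\}+\{a,\xi(b)\}$ for all $a,b\in A$. The grading in the completed sense: each $A/\mathfrak{m}^q$ is a direct sum $\bigoplus_p(A/\mathfrak{m}^q)^p$ with $(A/\mathfrak{m}^q)^p(A/\mathfrak{m}^q)^{p'}\subset(A/\mathfrak{m}^q)^{p+p'}$, the projections $A/\mathfrak{m}^{q+1}\to A/\mathfrak{m}^q$ are graded, and $A^p=\varprojlim_q(A/\mathfrak{m}^q)^p\subset A$. (Equivalently, a compatible system of algebraic $\mathbb{G}_m$-actions on the $A/\mathfrak{m}^q$.) *)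

(* Defs.v *)
From HB Require Import structures.
From mathcomp Require Import all_boot all_algebra.
From mathcomp Require Import boolp.

Set Implicit Arguments.
Unset Strict Implicit.
Unset Printing Implicit Defensive.

Import GRing.Theory.
Local Open Scope ring_scope.
Local Open Scope quotient_scope.

(* Subsets of a ring are boolean predicates, as required by {ideal_quot _}.
   Thanks to asbool (`[< _ >]) every subset arises in this way, so that
   quantifying over {pred A} is quantifying over all subsets of A. *)

Section CommutativeAlgebra.
Variable A : comNzRingType.

(* Ideals of A, the unit ideal included, are the submodules of A^o;
   idealr_closed, from ring_quotient, describes the proper ideals. *)
Definition ideal (I : {pred A}) : Prop := submod_closed (I : {pred A^o}).

Definition generates (s : seq A) (I : {pred A}) : Prop :=
  forall x, x \in I <-> exists c : 'I_(size s) -> A,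
    x = \sum_(i < size s) c i * s`_i.

Definition noetherian : Prop :=
  forall I : {pred A}, ideal I -> exists s : seq A, generates s I.

Definition maximal_ideal (I : {pred A}) : Prop :=
  idealr_closed I /\
  forall J : {pred A}, idealr_closed J -> {subset I <= J} -> J =i I.

Definition local_with (m : {pred A}) : Prop :=
  maximal_ideal m /\ forall m' : {pred A}, maximal_ideal m' -> m' =i m.

Definition ideal_prod (I J : {pred A}) : {pred A} := fun x =>
  `[< exists s : seq (A * A),
        (forall u, u \in s -> u.1 \in I /\ u.2 \in J) /\
        x = \sum_(u <- s) u.1 * u.2 >].

Fixpoint ideal_pow (I : {pred A}) (q : nat) : {pred A} :=
  if q is q'.+1 then ideal_prod I (ideal_pow I q') else predT.

Section Powers.
Variable m : idealr A.

Lemma ideal_pow_closed q : idealr_closed (ideal_pow m q.+1).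
Proof.
have sub x : x \in ideal_pow m q.+1 -> x \in m.
  move=> /asboolP[s [hs ->]]; rewrite big_seq; apply: rpred_sum => u us.
  by rewrite mulrC; apply: idealMr; case: (hs u us).
split.
- apply/asboolP; exists [::]; split; first by [].
  by rewrite big_nil.
- by apply/negP => /sub; rewrite idealr1.
- move=> a x y /asboolP[s [hs ->]] /asboolP[t [ht ->]]; apply/asboolP.
  exists ([seq (a * u.1, u.2) | u <- s] ++ t); split.
    move=> u; rewrite mem_cat => /orP[/mapP[v vs ->]|/ht //] /=.
    by have [v1 v2] := hs v vs; split => //; apply: idealMr.
  rewrite big_cat big_map mulr_sumr; congr (_ + _).
  by apply: eq_bigr => u _; rewrite mulrA.
Qed.

HB.instance Definition _ q :=
  isIdealr.Build A (ideal_pow m q.+1) (ideal_pow_closed q).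

Lemma ideal_powS q : {subset ideal_pow m q.+1 <= ideal_pow m q}.
Proof.
elim: q => [//|q IHq] x /asboolP[s [hs ->]]; apply/asboolP.
exists s; split => // u us; have [u1 u2] := hs u us.
by split => //; apply: IHq.
Qed.

End Powers.
End CommutativeAlgebra.

Section QuotientAlgebra.
Variables (k : fieldType) (A : comAlgType k) (I : idealr A).
Local Notation Q := {ideal_quot I}.

Definition quot_scale (c : k) (x : Q) : Q := \pi_Q (c *: repr x).

Lemma quot_scale_pi c (a : A) : quot_scale c (\pi_Q a) = \pi_Q (c *: a).
Proof.
apply/eqP; rewrite /quot_scale -Quotient.idealrBE -scalerBr -mulr_algl.
by apply: idealMr; rewrite Quotient.idealrBE; apply/eqP; exact: reprK.
Qed.

Let pi_add (a b : A) : \pi_Q (a + b) = \pi_Q a + \pi_Q b.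
Proof. exact: Quotient.pi_add. Qed.

Let pi_mul (a b : A) : \pi_Q (a * b) = \pi_Q a * \pi_Q b.
Proof. exact: Quotient.pi_mul. Qed.

Fact quot_scaleA c d x :
  quot_scale c (quot_scale d x) = quot_scale (c * d) x.
Proof.
by elim/quotW: x => a; rewrite (quot_scale_pi d) !quot_scale_pi scalerA.
Qed.

Fact quot_scale1 : left_id 1 quot_scale.
Proof. by elim/quotW=> a; rewrite quot_scale_pi scale1r. Qed.

Fact quot_scaleDr : right_distributive quot_scale +%R.
Proof.
move=> c; elim/quotW=> a; elim/quotW=> b.
by rewrite -pi_add !quot_scale_pi -pi_add scalerDr.
Qed.

Fact quot_scaleDl x : {morph quot_scale^~ x : c d / c + d}.
Proof.
move=> c d /=; elim/quotW: x => a.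
by rewrite !quot_scale_pi -pi_add scalerDl.
Qed.

HB.instance Definition _ := GRing.Zmodule_isLmodule.Build k
  (Quotient.quot I) quot_scaleA quot_scale1 quot_scaleDr quot_scaleDl.

Fact quot_scaleAl c (x y : Q) : c *: (x * y) = (c *: x) * y.
Proof.
elim/quotW: x => a; elim/quotW: y => b.
rewrite -pi_mul [LHS]quot_scale_pi [c *: _]quot_scale_pi.
by rewrite -pi_mul scalerAl.
Qed.

HB.instance Definition _ :=
  GRing.Lmodule_isLalgebra.Build k (Quotient.quot I) quot_scaleAl.
HB.instance Definition _ :=
  GRing.Lalgebra_isComAlgebra.Build k (Quotient.quot I).

End QuotientAlgebra.

Section Poisson.
Variables (k : fieldType) (A : comAlgType k).

Record poisson (br : {bilinear A -> A -> A}) : Prop := Poisson {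
  poisson_skew : forall a b, br a b = - br b a;
  poisson_leibniz : forall a b c : A, br a (b * c) = br a b * c + br a c * b;
  poisson_jacobi : forall a b c,
    br a (br b c) + br b (br c a) + br c (br a b) = 0;
  poisson_one : forall a, br 1 a = 0
}.

Definition derivation (D : {linear A -> A}) : Prop :=
  forall a b : A, D (a * b) = D a * b + a * D b.

Definition exact_poisson (br : {bilinear A -> A -> A}) : Prop :=
  exists xi : {linear A -> A}, derivation xi /\
    forall a b, xi (br a b) = br a b + br (xi a) b + br a (xi b).

End Poisson.

Definition direct_sum (k : fieldType) (V : lmodType k)
    (W : int -> {pred V}) : Prop :=
  [/\ forall p, submod_closed (W p),
      forall x, exists (s : seq int) (f : int -> V),
        [/\ uniq s, forall p, f p \in W p & x = \sum_(p <- s) f p]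
    & forall (s : seq int) (f : int -> V), uniq s ->
        (forall p, f p \in W p) -> \sum_(p <- s) f p = 0 ->
        forall p, p \in s -> f p = 0].

Section Completion.
Variables (k : fieldType) (A : comAlgType k) (m : idealr A).

Definition residue_field_is_base : Prop :=
  bijective (fun c : k => \pi_{ideal_quot m} (c%:A : A)).

(* The index is shifted: jet q is A/m^(q+1). The omitted term A/m^0 is the
   zero ring, which carries no information and is not a comNzRingType. *)
Definition jet (q : nat) := {ideal_quot (ideal_pow m q.+1)}.

HB.instance Definition _ q := GRing.ComAlgebra.on (jet q).

Definition to_jet (q : nat) (a : A) : jet q :=
  \pi_{ideal_quot (ideal_pow m q.+1)} a.

Definition jet_proj (q : nat) (x : jet q.+1) : jet q := to_jet q (repr x).

Lemma jet_proj_to_jet q a : jet_proj (to_jet q.+1 a) = to_jet q a.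
Proof.
apply/eqP; rewrite /jet_proj /to_jet -Quotient.idealrBE.
by apply: ideal_powS; rewrite Quotient.idealrBE; apply/eqP; exact: reprK.
Qed.

(* The canonical map from A to the inverse limit of the A/m^q is bijective. *)
Definition complete : Prop :=
  forall x : forall q, jet q, (forall q, jet_proj (x q.+1) = x q) ->
  exists! a : A, forall q, to_jet q a = x q.

Record completed_grading (gr : forall q, int -> {pred jet q}) : Prop :=
  CompletedGrading {
    grading_direct : forall q, direct_sum (gr q);
    grading_mul : forall q p p' x y,
      x \in gr q p -> y \in gr q p' -> x * y \in gr q (p + p');
    grading_proj : forall q p x, x \in gr q.+1 p -> jet_proj x \in gr q p
  }.

(* A^p, the inverse limit of the (A/m^q)^p viewed inside A *)
Definition degree_part (gr : forall q, int -> {pred jet q}) (p : int) (a : A)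
    : Prop :=
  forall q, to_jet q a \in gr q p.

End Completion.

(* Main.v *)
Require Import Defs.
From HB Require Import structures.
From mathcomp Require Import all_boot all_order all_algebra.
From mathcomp Require Import boolp classical_sets.
From mathcomp Require Import mxtens ring.

Set Implicit Arguments.
Unset Strict Implicit.
Unset Printing Implicit Defensive.

Import Order.TTheory GRing.Theory Num.Theory.
Local Open Scope ring_scope.

(** The grading comes from the eigenvalues of the derivation xi given by
    exactness.  As xi preserves m, it acts on every finite-dimensional
    quotient A/m^q.  If x and y lie in generalized eigenspaces of eigenvalues
    a and b, then x * y lies in that of a + b, because xi is a derivation, and
    {x, y} in that of a + b + 1, because xi({x, y}) exceeds the Leibniz
    expression by {x, y}.  So over an algebraically closed field A is graded,
    in the completed sense, by the additive group of the eigenvalues.  Every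
    eigenvalue is a sum of eigenvalues on A/m^2, so this group is finitely
    generated; a homomorphism to Z that does not vanish at 1 turns the grading
    into one by Z, and its value at 1 is the shift of the bracket.

    Two things must be done over k itself, where eigenvalues need not exist.
    First, an eigenvalue a, with irreducible polynomial R over k, enters only
    through its normalized trace, that is the mean of the roots of R: the trace
    is Galois-invariant and additive in a.  It is composed with an additive map
    phi : k -> Q such that phi 1 = 1 (exists_functional).  A polynomial has
    weight p when phi sends the mean of the roots of each of its irreducible
    factors to p (weight_poly), and the elements of weight p are those killed
    by F(xi) for some F of weight p (weight_space).

    Second, weights must add up under products, and this needs an argument that
    does not split R (weight_mxminpoly_add).  Let a and b be commuting matrices
    killed by polynomials of weights p and q, and let R be an irreducible
    factor of the minimal polynomial of c = a + b + t, t a scalar.  Some nonzero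
    subspace U killed by R(c) is stable under a, b and c.  A matrix of size d killed by a
    polynomial of weight r has a trace that phi sends to d * r (weight_trace).
    Taking traces on U in c = a + b + t gives that R has weight p + q + phi(t).
    Applied to Kronecker sums of companion matrices, this shows that a bilinear
    map compatible with xi adds weights, up to a shift
    (weight_space_bilinear).

    The weights on A/m^2 are finitely many rationals, with a common denominator
    N.  The elements of A/m^q that are sums of elements with weights in (1/N)Z
    form a subalgebra that maps onto A/m^2, hence equal to A/m^q because m is
    nilpotent there (integral_decomposition).  Multiplication by N then gives
    the grading by Z, with bracket of degree N. *)

(** * An additive map from a field of characteristic zero to the rationals *)

Section AdditiveFunctional.
Variable k : fieldType.

(** A subspace of k, seen as a rational vector space, that meets the line
    spanned by 1 trivially.  The empty set is admitted, so that the union of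
    the empty chain qualifies. *)
Definition avoids_one (M : set k) : Prop :=
  [/\ forall x y, M x -> M y -> M (x - y),
      forall x n, M (x *+ n.+1) -> M x & ~ M 1].

Lemma avoids_one_chain (F : set (set k)) :
  (F `<=` avoids_one)%classic -> total_on F subset ->
  avoids_one (\bigcup_(X in F) X)%classic.
Proof.
move=> FP tot; split.
- move=> x y [X FX Xx] [Y FY Yy].
  case: (tot X Y FX FY) => [XY|YX].
    by exists Y => //; have [sub _ _] := FP _ FY; apply: sub => //; apply: XY.
  by exists X => //; have [sub _ _] := FP _ FX; apply: sub => //; apply: YX.
- by move=> x n [X FX Xx]; exists X => //; have [_ dv _] := FP _ FX; apply: dv Xx.
- by move=> [X FX X1]; have [_ _] := FP _ FX; apply.
Qed.

Section Closure.
Variable M : set k.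
Hypothesis PM : avoids_one M.

Lemma avoids_oneN x : M x -> M (- x).
Proof.
have [Msub _ _] := PM => Mx; rewrite -sub0r; apply: (Msub) => //.
by rewrite -(subrr x); apply: Msub.
Qed.

Lemma avoids_oneD x y : M x -> M y -> M (x + y).
Proof.
have [Msub _ _] := PM => Mx My.
by rewrite -[y]opprK; apply: Msub => //; apply: avoids_oneN.
Qed.

Lemma avoids_oneMn x n : M x -> M (x *+ n).
Proof.
have [Msub _ _] := PM => Mx; elim: n => [|n IHn].
  by rewrite mulr0n -(subrr x); apply: Msub.
by rewrite mulrS; apply: avoids_oneD.
Qed.

Lemma avoids_oneMz x (i : int) : M x -> M (x *~ i).
Proof.
case: i => n Mx; first exact: avoids_oneMn.
by rewrite NegzE mulrNz; apply/avoids_oneN/(avoids_oneMn n.+1).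
Qed.

Lemma avoids_one_divz x (i : int) : i != 0 -> M (x *~ i) -> M x.
Proof.
have [_ Mdiv _] := PM.
case: i => [[//|n] _ /Mdiv //|n _ /avoids_oneN].
by rewrite NegzE mulrNz opprK => /Mdiv.
Qed.

Lemma avoids_one_int (i : int) : M i%:~R -> i = 0.
Proof.
have [_ _ M1] := PM => Mi; apply/eqP/negPn/negP => i0.
by apply: M1; apply: avoids_one_divz i0 Mi.
Qed.

End Closure.

Hypothesis chark0 : [pchar k] =i pred0.

Lemma natS_neq0 n : (n.+1%:R : k) != 0.
Proof. by rewrite (proj1 (pcharf0P k) chark0). Qed.

(** A maximal M is a complement of the line spanned by 1: if x is not in M,
    adding x to M produces 1. *)
Lemma exists_complement : exists M : set k, avoids_one M /\
  forall x, exists r : rat, M ((denq r)%:~R * x - (numq r)%:~R).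
Proof.
have [M [PM maxM]] := Zorn_bigcup avoids_one_chain.
have [Msub Mdiv M1] := PM.
have M0 : M 0.
  apply: contrapT => M0; apply: (maxM (fun x => x = 0)).
    split; last by move=> e; apply: M0; exact: (e 0 erefl).
    move=> x Mx /=; case: M0.
    by rewrite -(subrr x); apply: Msub.
  split; [by move=> x y -> ->; rewrite subr0| |by apply/eqP; rewrite oner_eq0].
  move=> x n /eqP; rewrite -mulr_natr mulf_eq0 (negPf (natS_neq0 n)) orbF.
  by move/eqP.
exists M; split => // x.
suff [i [j [i0 Mij]]] : exists i j : int, i != 0 /\ M (i%:~R * x - j%:~R).
  exists (j%:~R / i%:~R); set r := (_ / _).
  have /eqP : (numq r)%:~R * i%:~R = j%:~R * (denq r)%:~R :> rat.
    have /eqP e := divq_num_den r; apply/eqP.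
    by rewrite -eqr_div ?intr_eq0 ?denq_neq0.
  rewrite -!intrM eqr_int => /eqP e.
  have ek : (numq r)%:~R * i%:~R = j%:~R * (denq r)%:~R :> k.
    by rewrite -(intrM k (numq r) i) -(intrM k j (denq r)) e.
  apply: (avoids_one_divz PM i0); rewrite -mulrzr mulrBl ek -mulrA.
  rewrite [_%:~R * (x * _)]mulrC -mulrBl mulrzr [x * _]mulrC.
  exact: avoids_oneMz.
case: (pselect (M x)) => Mx.
  by exists 1, 0; split=> //; rewrite mul1r subr0.
(* the rational subspace spanned by M and x *)
pose X' : set k := fun y => exists (n : nat) (i : int),
  (0 < n)%N /\ M (y *+ n - x *~ i).
apply: contrapT => nij; apply: (maxM X').
  split; first by move=> y My; exists 1%N, 0; rewrite subr0.
  by move=> /(_ x) h; apply: Mx; apply: h; exists 1%N, 1; rewrite subrr.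
split.
- move=> y z [n [i [n0 My]]] [n' [i' [n'0 Mz]]].
  exists (n * n')%N, (i * n' - i' * n); split; first by rewrite muln_gt0 n0.
  have := Msub _ _ (avoids_oneMn PM n' My) (avoids_oneMn PM n Mz).
  suff -> : (y - z) *+ (n * n') - x *~ (i * n' - i' * n) =
    (y *+ n - x *~ i) *+ n' - (z *+ n' - x *~ i') *+ n by [].
  by ring.
- move=> y n [n' [i [n'0 My]]]; exists (n.+1 * n')%N, i.
  by rewrite muln_gt0 mulrnA.
- move=> [n [i [n0 Mn]]]; apply: nij; exists i, (Posz n); split.
    apply/eqP => i0; move: Mn; rewrite i0 subr0.
    by case: n n0 => // n _ /Mdiv.
  by rewrite mulrzl -opprB; apply: avoids_oneN.
Qed.

(** The projection onto the line of 1 along the complement. *)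
Lemma exists_functional : exists phi : k -> rat,
  (forall x y, phi (x + y) = phi x + phi y) /\ phi 1 = 1.
Proof.
have [M [PM Mr]] := exists_complement; have [Msub _ _] := PM.
have [phi Mphi] := choice Mr.
have uniq x (r : rat) (d n : int) : d != 0 -> r = n%:~R / d%:~R ->
    M (d%:~R * x - n%:~R) -> phi x = r.
  move=> d0 -> Md; apply/eqP; rewrite -[phi x]divq_num_den.
  rewrite eqr_div ?intr_eq0 ?denq_neq0 // -!intrM eqr_int -subr_eq0; apply/eqP.
  apply: (avoids_one_int PM).
  have := Msub _ _ (avoids_oneMz PM (denq (phi x)) Md) (avoids_oneMz PM d (Mphi x)).
  move: (denq (phi x)) (numq (phi x)) => d' n'.
  suff -> : (d%:~R * x - n%:~R) *~ d' - (d'%:~R * x - n'%:~R) *~ d =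
    (n' * d - n * d')%:~R by [].
  by ring.
exists phi; split=> [x y|].
  apply: (@uniq _ _ (denq (phi x) * denq (phi y))
    (numq (phi x) * denq (phi y) + numq (phi y) * denq (phi x))).
  - by rewrite mulf_neq0 ?denq_neq0.
  - by rewrite -{1}[phi x]divq_num_den -{1}[phi y]divq_num_den addf_div
      ?intr_eq0 ?denq_neq0 // -!intrM -intrD.
  have := avoids_oneD PM (avoids_oneMz PM (denq (phi y)) (Mphi x))
    (avoids_oneMz PM (denq (phi x)) (Mphi y)).
  move: (denq (phi x)) (numq (phi x)) (denq (phi y)) (numq (phi y)) => d n d' n'.
  suff -> : (d%:~R * x - n%:~R) *~ d' + (d'%:~R * y - n'%:~R) *~ d =
    (d * d')%:~R * (x + y) - (n * d' + n' * d)%:~R by [].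
  by ring.
apply: (@uniq _ _ 1 1); rewrite ?divr1 // mulr1 subrr.
exact: (avoids_oneMn PM 0 (Mphi 0)).
Qed.

End AdditiveFunctional.

(** * Irreducible factors and sums of roots *)
Section Factors.
Variable k : fieldType.
Implicit Types F G R : {poly k}.

Lemma exists_irreducible_factor F : (1 < size F)%N ->
  exists R, [/\ R \is monic, irreducible_poly R & R %| F].
Proof.
have [n] := ubnP (size F); elim: n F => // n IHn F ltFn F1.
have F0 : F != 0 by rewrite -size_poly_gt0 ltnW.
case: (pselect (exists G, [/\ size G != 1%N, G %| F & (size G < size F)%N])).
  move=> [G [G1 GF ltGF]].
  have G0 : G != 0 by apply: dvdpN0 GF F0.
  have [||R [mR iR RG]] := IHn G.
  - exact: leq_trans ltGF _.
  - by rewrite ltn_neqAle eq_sym G1 size_poly_gt0.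
  by exists R; split=> //; apply: dvdp_trans GF.
move=> noG; exists ((lead_coef F)^-1 *: F).
have eF : (lead_coef F)^-1 *: F %= F by rewrite eqp_scale // invr_eq0 lead_coef_eq0.
split; last by rewrite (eqp_dvdl _ eF).
  by rewrite monicE lead_coefZ mulVf // lead_coef_eq0.
split=> [|G G1]; first by rewrite (eqp_size eF).
rewrite (eqp_dvdr _ eF) (eqp_rtrans eF) => GF.
rewrite -dvdp_size_eqp // eqn_leq dvdp_leq //= leqNgt; apply/negP => lt.
by apply: noG; exists G.
Qed.

Lemma irreducible_dvdM R F G : irreducible_poly R ->
  R %| F * G -> (R %| F) || (R %| G).
Proof.
move=> iR; case: (boolP (R %| F)) => //= RF.
by rewrite Gauss_dvdpr // irreducible_poly_coprime.
Qed.

(** The sum of the roots of a monic F.  The factor 'X makes it 0, rather than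
    the constant coefficient, when F = 1. *)
Definition rootsum F : k := - ('X * F)`_(size F).-1.

Lemma rootsumM F G : F \is monic -> G \is monic ->
  rootsum (F * G) = rootsum F + rootsum G.
Proof.
move=> mF mG; rewrite /rootsum -opprD; congr (- _).
have [m sF] : exists m, size F = m.+1.
  by exists (size F).-1; rewrite prednK // size_poly_gt0 monic_neq0.
have [n sG] : exists n, size G = n.+1.
  by exists (size G).-1; rewrite prednK // size_poly_gt0 monic_neq0.
(* The product of F - 'X^m and G - 'X^n has degree below m+n-1, so it does not
   contribute to the coefficient of 'X^(m+n-1). *)
have tail (H : {poly k}) (d : nat) :
    H \is monic -> size H = d.+1 -> (size (H - 'X^d)%R <= d)%N.
  move=> mH sH; apply/leq_sizeP => j; rewrite leq_eqVlt coefB coefXn.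
  case/predU1P => [<-|ltj]; rewrite ?eqxx.
    by move/monicP: mH; rewrite lead_coefE sH => ->; rewrite subrr.
  by rewrite gtn_eqF // subr0 nth_default // sH.
have sFr := tail F m mF sF; have sGr := tail G n mG sG.
rewrite size_monicM ?monic_neq0 // sF sG addSn /= addnS /=.
have -> : 'X * (F * G) = 'X^m * ('X * G) + 'X^n * ('X * (F - 'X^m))
    + 'X * ((F - 'X^m) * (G - 'X^n)) by ring.
have top : ('X * ((F - 'X^m) * (G - 'X^n)))`_(m + n) = 0.
  rewrite coefXM; case: eqP => // /eqP mn0.
  have := size_polyMleq (F - 'X^m) (G - 'X^n).
  move=> s; apply: nth_default; apply: leq_trans s _.
  by rewrite -!subn1 leq_sub2r // leq_add.
rewrite !coefD top addr0 !coefXnM.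
rewrite ltnNge leq_addr /= addKn ltnNge leq_addl /= addnK mulrBr coefB.
rewrite -['X * 'X^m]exprS coefXn [m == _]ltn_eqF // subr0.
by rewrite addrC.
Qed.

End Factors.

(** * Polynomials of a given weight *)

Section WeightPolynomials.
Variables (k : fieldType) (phi : k -> rat).
Hypothesis phiD : forall x y, phi (x + y) = phi x + phi y.
Implicit Types F G R : {poly k}.

Lemma phi0 : phi 0 = 0.
Proof. by apply: (addrI (phi 0)); rewrite -phiD !addr0. Qed.

Lemma phiMn x n : phi (x *+ n) = phi x *+ n.
Proof. by elim: n => [|n IHn]; rewrite ?phi0 // !mulrS phiD IHn. Qed.

(** The condition says that phi sends the mean of the roots of R to p; it is
    multiplied out by the degree of R. *)
Definition weight_poly (p : rat) F : Prop := F != 0 /\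
  forall R, R \is monic -> irreducible_poly R -> R %| F ->
    phi (rootsum R) = (size R).-1%:R * p.

Lemma weight_poly1 p : weight_poly p 1.
Proof.
split=> [|R _ [R1 _] /(dvdp_leq (oner_neq0 _))]; first exact: oner_neq0.
by rewrite size_poly1 leqNgt R1.
Qed.

Lemma weight_polyM p F G :
  weight_poly p F -> weight_poly p G -> weight_poly p (F * G).
Proof.
move=> [F0 wF] [G0 wG]; split=> [|R mR iR /(irreducible_dvdM iR)/orP[]].
- by rewrite mulf_neq0.
- exact: wF.
- exact: wG.
Qed.

Lemma weight_polyX p F n : weight_poly p F -> weight_poly p (F ^+ n).
Proof.
move=> wF; elim: n => [|n IHn]; first exact: weight_poly1.
by rewrite exprS; apply: weight_polyM.
Qed.

Lemma weight_poly_dvd p F G : G %| F -> weight_poly p F -> weight_poly p G.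
Proof.
move=> GF [F0 wF]; split=> [|R mR iR RG]; first exact: dvdpN0 GF F0.
by apply: wF => //; apply: dvdp_trans GF.
Qed.

Lemma degree_neq0 R : irreducible_poly R -> ((size R).-1%:R : rat) != 0.
Proof. by case=> R1 _; rewrite pnatr_eq0; case: (size R) R1 => [|[]]. Qed.

Lemma weight_poly_irreducible R : R \is monic -> irreducible_poly R ->
  weight_poly (phi (rootsum R) / (size R).-1%:R) R.
Proof.
move=> mR iR; split=> [|S mS iS SR]; first exact: monic_neq0.
have /eqP -> : S == R by rewrite -eqp_monic //; apply: iR => //; rewrite gtn_eqF // iS.1.
by rewrite mulrC divfK // degree_neq0.
Qed.

Lemma weight_poly_rootsum p F : F \is monic -> weight_poly p F ->
  phi (rootsum F) = (size F).-1%:R * p.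
Proof.
have [n] := ubnP (size F); elim: n F => // n IHn F ltFn mF wF.
have [F1|/exists_irreducible_factor [R [mR iR RF]]] := leqP (size F) 1.
  have /eqP s1 : size F == 1%N by rewrite eqn_leq F1 size_poly_gt0 monic_neq0.
  by rewrite /rootsum s1 coefXM eqxx oppr0 phi0 mul0r.
have [G eF] := dvdpP _ _ RF; have mG : G \is monic by rewrite eF monicMr in mF.
have sR : (1 < size R)%N := iR.1.
have G0 : (0 < size G)%N by rewrite size_poly_gt0 monic_neq0.
have sF : (size F = size G + (size R).-1)%N.
  by rewrite eF size_monicM ?monic_neq0 // -(prednK (ltnW sR)) addnS.
rewrite eF rootsumM // phiD IHn //.
- rewrite wF.2 // -mulrDl -natrD -eF sF; congr (_%:R * _).
  by case: (size G) G0.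
- rewrite -ltnS; apply: leq_trans ltFn; rewrite ltnS sF.
  by rewrite -addn1 leq_add2l -ltnS prednK // ltnW.
- by apply: weight_poly_dvd wF; rewrite eF dvdp_mulr.
Qed.

Lemma weight_poly_coprime p q F G : p != q ->
  weight_poly p F -> weight_poly q G -> coprimep F G.
Proof.
move=> pq [F0 wF] [G0 wG]; rewrite /coprimep eqn_leq size_poly_gt0.
rewrite gcdp_eq0 negb_and F0 /= andbT leqNgt; apply/negP.
move=> /exists_irreducible_factor [R [mR iR]]; rewrite dvdp_gcd => /andP[RF RG].
move/negP: pq; apply; apply/eqP; apply: (mulfI (degree_neq0 iR)).
by rewrite -wF // -wG.
Qed.

(** G collects the irreducible factors of weight p. *)
Lemma weight_split p F : F != 0 -> exists G H,
  [/\ F = G * H, weight_poly p G & forall G', weight_poly p G' -> coprimep G' H].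
Proof.
have [n] := ubnP (size F); elim: n F => // n IHn F ltFn F0.
case: (pselect (exists R, [/\ R \is monic, irreducible_poly R, R %| F
    & phi (rootsum R) = (size R).-1%:R * p])).
  move=> [R [mR iR /dvdpP[F' eF] wR]].
  have F'0 : F' != 0 by apply: contraNneq F0 => F'0; rewrite eF F'0 mul0r.
  have sR : (1 < size R)%N := iR.1.
  have [|G [H [eF' wG cH]]] := IHn F' _ F'0.
    rewrite -ltnS; apply: leq_trans ltFn; rewrite ltnS eF size_Mmonic //.
    by rewrite -(prednK (ltnW sR)) addnS /= -addn1 leq_add2l -ltnS prednK // ltnW.
  exists (R * G), H; split=> //; first by rewrite eF eF' mulrC mulrA.
  apply: weight_polyM wG.
  have := weight_poly_irreducible mR iR.
  by rewrite wR mulrC mulKf ?degree_neq0.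
move=> noR; exists 1, F; split=> //; first by rewrite mul1r.
  exact: weight_poly1.
move=> G [G0 wG]; rewrite /coprimep eqn_leq size_poly_gt0.
rewrite gcdp_eq0 negb_and G0 /= andbT leqNgt; apply/negP.
move=> /exists_irreducible_factor [R [mR iR]]; rewrite dvdp_gcd => /andP[RG RF].
by apply: noR; exists R; split=> //; apply: wG.
Qed.

(** As F(A) = 0, the scalar matrix F is F - F(A), a multiple of 'X - A; the
    claim follows by taking determinants. *)
Lemma char_poly_dvd_exp n (A : 'M[k]_n.+1) F :
  horner_mx A F = 0 -> char_poly A %| F ^+ n.+1.
Proof.
move=> AF.
have [Q eQ] : exists Q : 'M[{poly k}]_n.+1,
    F%:M - map_mx polyC (horner_mx A F) = char_poly_mx A *m Q.
  elim/poly_ind: F {AF} => [|F c [Q eQ]].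
    by exists 0; rewrite (rmorph0 (horner_mx A)) map_mx0 subr0 mulmx0 raddf0.
  exists (Q *m 'X%:M + map_mx polyC (horner_mx A F)).
  have -> : horner_mx A (F * 'X + c%:P) = horner_mx A F *m A + c%:M.
    by rewrite rmorphD rmorphM /= horner_mx_X horner_mx_C.
  have -> : (F * 'X + c%:P)%:M = F%:M *m 'X%:M + c%:P%:M :> 'M_n.+1.
    by rewrite -scalar_mxM -raddfD.
  rewrite mulmxDr mulmxA -eQ map_mxD map_mxM map_scalar_mx /= /char_poly_mx.
  have cA : map_mx polyC A *m map_mx polyC (horner_mx A F) =
      map_mx polyC (horner_mx A F) *m map_mx polyC A.
    by rewrite -!map_mxM; congr map_mx; apply: comm_mx_horner.
  rewrite !mulmxBl cA; rewrite -[X in _ + (X - _)]scalar_mxC.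
  by rewrite opprD addrACA subrr addr0 addrA subrK.
apply/dvdpP; exists (\det Q); rewrite mulrC /char_poly -det_mulmx -eQ AF.
by rewrite map_mx0 subr0 det_scalar.
Qed.

(** The characteristic polynomial of A has only irreducible factors of F, and
    the trace is the sum of its roots. *)
Lemma weight_trace n (A : 'M[k]_n.+1) p F :
  weight_poly p F -> horner_mx A F = 0 -> phi (\tr A) = n.+1%:R * p.
Proof.
move=> wF AF.
have := weight_poly_rootsum (char_poly_monic A)
  (weight_poly_dvd (char_poly_dvd_exp AF) (weight_polyX _ wF)).
by rewrite /rootsum size_char_poly coefXM /= (char_poly_trace A (ltn0Sn n)) opprK.
Qed.

(** Stands for the additivity of eigenvalues of commuting matrices, without
    any eigenvalue: traces are compared on a common stable subspace. *)
Lemma weight_mxminpoly_add n (A B : 'M[k]_n.+1) (c : k) p q F G :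
  weight_poly p F -> weight_poly q G ->
  horner_mx A F = 0 -> horner_mx B G = 0 -> comm_mx A B ->
  weight_poly (p + q + phi c) (mxminpoly (A + B + c%:M)).
Proof.
move=> wF wG AF BG AB; set C := A + B + c%:M.
split=> [|R mR iR RC]; first by rewrite monic_neq0 // mxminpoly_monic.
have [S eS] := dvdpP _ _ RC.
have S0 : horner_mx C S != 0.
  apply/negP => /eqP/mxminpoly_min; rewrite eS.
  have S0 : S != 0.
    apply: contraTneq (mxminpoly_monic C) => S0.
    by rewrite eS S0 mul0r monicE lead_coef0 eq_sym oner_eq0.
  move/(dvdp_leq S0); rewrite size_Mmonic // leqNgt.
  rewrite -(prednK (ltnW iR.1)) addnS /= -{1}[size S]addn0 ltn_add2l.
  by rewrite -ltnS prednK ?iR.1 // ltnW // iR.1.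
(* V is the image of S(C), where R * S is the minimal polynomial of C: it is
   nonzero, killed by R(C), and stable under whatever commutes with C. *)
have [r [V [Vfree eV]]] : exists r (V : 'M[k]_(r.+1, n.+1)),
    row_free V /\ (V :=: horner_mx C S)%MS.
  have : \rank (horner_mx C S) != 0%N by rewrite mxrank_eq0.
  move: (row_base_free (horner_mx C S)) (eq_row_base (horner_mx C S)).
  move: (row_base (horner_mx C S)); case: (\rank _) => // r V Vfree eV _.
  by exists r, V.
have stable f : comm_mx f C -> stablemx V f.
  move=> fC; rewrite (eqmxMr f eV) eV; apply/submxP; exists f.
  by rewrite (comm_mx_horner S fC).
have Cc D : comm_mx D c%:M by rewrite /comm_mx scalar_mxC.
have sA : stablemx V A by apply/stable/comm_mxD/Cc/comm_mxD.
have sB : stablemx V B.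
  by apply/stable/comm_mxD/Cc/comm_mxD => //; apply: comm_mx_sym.
have sC : stablemx V C by apply: stable.
have AV : horner_mx (conjmx V A) F = 0 by rewrite horner_mx_conj // AF conjmx0.
have BV : horner_mx (conjmx V B) G = 0 by rewrite horner_mx_conj // BG conjmx0.
have CV : horner_mx (conjmx V C) R = 0.
  rewrite horner_mx_conj // /conjmx.
  have [W ->] : exists W, V = W *m horner_mx C S by apply/submxP; rewrite eV.
  have SR0 : horner_mx C S *m horner_mx C R = 0.
    by have := mx_root_minpoly C; rewrite eS rmorphM.
  by rewrite -(mulmxA W) SR0 mulmx0 mul0mx.
have tC : \tr (conjmx V C) = \tr (conjmx V A) + \tr (conjmx V B) + c *+ r.+1.
  rewrite -(mxtrace_scalar r.+1 c) -[c%:M](conjmx_scalar _ Vfree) -!raddfD /=.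
  by rewrite /conjmx /C !mulmxDr !mulmxDl.
have := weight_trace (weight_poly_irreducible mR iR) CV.
rewrite tC !phiD phiMn (weight_trace wF AV) (weight_trace wG BV).
rewrite -[phi c *+ _]mulr_natl -!mulrDr.
have r0 : (r.+1%:R : rat) != 0 by rewrite pnatr_eq0.
by move/(mulfI r0) => ->; rewrite mulrC divfK // degree_neq0.
Qed.

End WeightPolynomials.

(** * The action of polynomials in an endomorphism, modulo a stable subspace *)

Section SubmodClosed.
Variables (R : nzRingType) (V : lmodType R) (I : {pred V}).
Hypothesis Iclosed : submod_closed I.

Lemma submod_mem0 : 0 \in I. Proof. by case: Iclosed. Qed.

Lemma submod_memP c x y : x \in I -> y \in I -> c *: x + y \in I.
Proof. by case: Iclosed => _; apply. Qed.

Lemma submod_memD x y : x \in I -> y \in I -> x + y \in I.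
Proof. by move=> Ix Iy; rewrite -[x]scale1r submod_memP. Qed.

Lemma submod_memZ c x : x \in I -> c *: x \in I.
Proof. by move=> Ix; rewrite -[_ *: _]addr0 submod_memP ?submod_mem0. Qed.

Lemma submod_memB x y : x \in I -> y \in I -> x - y \in I.
Proof. by move=> Ix Iy; rewrite addrC -scaleN1r submod_memP. Qed.

Lemma submod_mem_sum (J : Type) (r : seq J) (P : pred J) (f : J -> V) :
  (forall j, P j -> f j \in I) -> \sum_(j <- r | P j) f j \in I.
Proof.
by move=> If; elim/big_ind: _ => //; [exact: submod_mem0|exact: submod_memD].
Qed.

End SubmodClosed.

Section PolynomialAction.
Variables (k : fieldType) (V : lmodType k) (T : {linear V -> V}).
Implicit Types (F G : {poly k}) (x y : V).

Definition act F x := \sum_(i < size F) F`_i *: iter i T x.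

Lemma act_widen n F x : (size F <= n)%N ->
  act F x = \sum_(i < n) F`_i *: iter i T x.
Proof.
move=> leFn; rewrite /act (big_ord_widen n (fun i => F`_i *: iter i T x) leFn).
rewrite big_mkcond; apply: eq_bigr => i _.
by case: ltnP => // le; rewrite nth_default // scale0r.
Qed.

Lemma iter_linear n c x y : iter n T (c *: x + y) = c *: iter n T x + iter n T y.
Proof. by elim: n => //= n ->; rewrite linearP. Qed.

Lemma act_linear F : linear (act F).
Proof.
move=> c x y; rewrite /act scaler_sumr -big_split; apply: eq_bigr => i _ /=.
by rewrite iter_linear scalerDr !scalerA mulrC.
Qed.

HB.instance Definition _ F := GRing.isLinear.Build k V V *:%R (act F) (act_linear F).

Lemma actD F G x : act (F + G) x = act F x + act G x.
Proof.
have leF := leq_maxl (size F) (size G); have leG := leq_maxr (size F) (size G).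
rewrite (act_widen x (size_polyD F G)) (act_widen x leF) (act_widen x leG).
rewrite -big_split.
by apply: eq_bigr => i _; rewrite coefD scalerDl.
Qed.

Lemma actZ c F x : act (c *: F) x = c *: act F x.
Proof.
rewrite (act_widen x (size_scale_leq c F)) scaler_sumr.
by apply: eq_bigr => i _; rewrite coefZ scalerA.
Qed.

Lemma act1 x : act 1 x = x.
Proof. by rewrite /act size_poly1 big_ord1 coef1 scale1r. Qed.

Lemma actXM F x : act ('X * F) x = T (act F x).
Proof.
have s : (size ('X * F)%R <= (size F).+1)%N.
  by rewrite (leq_trans (size_polyMleq _ _)) // size_polyX.
rewrite (act_widen x s) big_ord_recl coefXM scale0r add0r linear_sum.
by apply: eq_bigr => i _; rewrite linearZ coefXM.
Qed.

Lemma actX x : act 'X x = T x.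
Proof. by rewrite -['X]mulr1 actXM act1. Qed.

Lemma actM F G x : act (F * G) x = act F (act G x).
Proof.
elim/poly_ind: F => [|F c IHF] in G x *.
  by rewrite mul0r /act size_poly0 !big_ord0.
have -> : (F * 'X + c%:P) * G = F * ('X * G) + c *: G.
  by rewrite mulrDl -mulrA mul_polyC.
by rewrite !actD !IHF actXM actX actZ -alg_polyC actZ act1.
Qed.

Variable I : {pred V}.
Hypotheses (Iclosed : submod_closed I) (Istable : forall x, x \in I -> T x \in I).

Lemma act_stable F x : x \in I -> act F x \in I.
Proof.
move=> Ix; apply: (submod_mem_sum Iclosed) => i _; apply: (submod_memZ Iclosed).
by elim: (i : nat) => //= n; apply: Istable.
Qed.

(** If v spans a subspace modulo I on which T acts by M, then F(T) acts on it
    by F(M). *)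
Lemma act_family n (v : 'I_n.+1 -> V) (M : 'M[k]_n.+1) F i :
  (forall i, T (v i) - \sum_j M i j *: v j \in I) ->
  horner_mx M F = 0 -> act F (v i) \in I.
Proof.
move=> Mv MF.
suff: act F (v i) - \sum_j horner_mx M F i j *: v j \in I.
  by rewrite MF big1 ?subr0 // => j _; rewrite mxE scale0r.
elim/poly_ind: F {MF} i => [|F c IHF] i.
  rewrite rmorph0 /act size_poly0 big_ord0 big1 ?subrr ?(submod_mem0 Iclosed) // => j _.
  by rewrite mxE scale0r.
have -> : horner_mx M (F * 'X + c%:P) = M *m horner_mx M F + c%:M.
  rewrite rmorphD rmorphM /= horner_mx_X horner_mx_C.
  by congr (_ + _); apply: comm_horner_mx.
set H := horner_mx M F in IHF *.
have -> : act (F * 'X + c%:P) (v i) - \sum_j (M *m H + c%:M) i j *: v j =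
    act F (T (v i) - \sum_j M i j *: v j)
    + \sum_j M i j *: (act F (v j) - \sum_l H j l *: v l).
  have eM : act F (\sum_j M i j *: v j) = \sum_j M i j *: act F (v j).
    by rewrite linear_sum; apply: eq_bigr => j _; rewrite linearZ.
  have eH : \sum_j M i j *: (\sum_l H j l *: v l) = \sum_l (M *m H) i l *: v l.
    under eq_bigr do rewrite scaler_sumr.
    rewrite exchange_big; apply: eq_bigr => l _; rewrite mxE scaler_suml.
    by apply: eq_bigr => j _; rewrite scalerA.
  have ec : \sum_j (M *m H + c%:M) i j *: v j =
      \sum_l (M *m H) i l *: v l + c *: v i.
    under eq_bigr do rewrite mxE scalerDl.
    rewrite big_split /=; congr (_ + _); rewrite (bigD1 i) //= mxE eqxx mulr1n.
    rewrite big1 ?addr0 // => j /negPf ji; by rewrite mxE eq_sym ji scale0r.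
  under [X in _ = _ + X]eq_bigr do rewrite scalerBr.
  rewrite sumrB eH ec actD actM actX -alg_polyC actZ act1 linearB /= eM.
  by rewrite addrA subrK opprD addrACA subrr addr0.
apply: (submod_memD Iclosed); first exact/act_stable.
by apply: (submod_mem_sum Iclosed) => j _; apply: (submod_memZ Iclosed).
Qed.

End PolynomialAction.

(** * Companion matrices and Kronecker sums *)

Section Companion.
Variable k : fieldType.

Lemma companion_matrix (F : {poly k}) n : F \is monic -> size F = n.+2 ->
  exists M : 'M[k]_n.+1, horner_mx M F = 0 /\
    forall i j, M i j = if i == n :> nat then - F`_j else (i.+1 == j :> nat)%:R.
Proof.
move=> mF sF; exists (\matrix_(i < n.+1, j < n.+1)
  if i == n :> nat then - F`_j else (i.+1 == j :> nat)%:R).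
have companion d : (size F).-1 = d ->
    char_poly (\matrix_(i < d, j < d)
      if i == d.-1 :> nat then - F`_j else (i.+1 == j :> nat)%:R) = F.
  by move=> <-; exact: companionmxK.
split=> [|i j]; last by rewrite mxE.
have {2}<- := companion n.+1 (congr1 predn sF); exact: Cayley_Hamilton.
Qed.

(** The Kronecker product with an identity matrix.  Its size m.+1 * n.+1 is
    spelt as a successor, for square matrices to form a unital ring and
    polynomials to be evaluated at them. *)
Definition tens_left m n (A : 'M[k]_m.+1) : 'M[k]_((n + m * n.+1).+1) :=
  A *t (1%:M : 'M_n.+1).

Definition tens_right m n (B : 'M[k]_n.+1) : 'M[k]_((n + m * n.+1).+1) :=
  (1%:M : 'M_m.+1) *t B.

Lemma tensmx_scalar m n (c : k) : (c%:M : 'M_(m * n)) = c%:M *t 1%:M.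
Proof.
apply/matrixP=> i j; case: (mxtens_indexP i) => i1 i2.
case: (mxtens_indexP j) => j1 j2; rewrite tensmxE !mxE.
rewrite (can_eq (@mxtens_indexK _ _)) xpair_eqE.
by case: (i1 == j1); case: (i2 == j2); rewrite ?mulr1 ?mulr0 ?mul0r.
Qed.

Lemma tens_leftM m n (A B : 'M[k]_m.+1) :
  tens_left n A *m tens_left n B = tens_left n (A *m B).
Proof. by have := tensmx_mul A (1%:M : 'M_n.+1) B 1%:M; rewrite mulmx1. Qed.

Lemma tens_rightM m n (A B : 'M[k]_n.+1) :
  tens_right m A *m tens_right m B = tens_right m (A *m B).
Proof. by have := tensmx_mul (1%:M : 'M_m.+1) A 1%:M B; rewrite mulmx1. Qed.

Lemma horner_tens_left m n (A : 'M[k]_m.+1) (F : {poly k}) :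
  horner_mx (tens_left n A) F = tens_left n (horner_mx A F).
Proof.
elim/poly_ind: F => [|F c IHF].
  by rewrite !rmorph0 /tens_left tens0mx.
rewrite !rmorphD !rmorphM /= !horner_mx_X !horner_mx_C IHF.
rewrite [_ * tens_left _ _]tens_leftM.
apply/matrixP=> i j; rewrite [RHS]mxE [LHS]mxE (tensmx_scalar m.+1 n.+1 c).
by rewrite !mxE -mulrDl.
Qed.

Lemma horner_tens_right m n (B : 'M[k]_n.+1) (F : {poly k}) :
  horner_mx (tens_right m B) F = tens_right m (horner_mx B F).
Proof.
elim/poly_ind: F => [|F c IHF].
  by rewrite !rmorph0 /tens_right tensmx0.
rewrite !rmorphD !rmorphM /= !horner_mx_X !horner_mx_C IHF.
rewrite [_ * tens_right _ _]tens_rightM.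
apply/matrixP=> i j; rewrite [RHS]mxE [LHS]mxE (tensmx_scalar m.+1 n.+1 c).
rewrite !mxE mulrDr; congr (_ + _).
by case: (_ == _); case: (_ == _); rewrite ?mulr1 ?mulr0 ?mul0r ?mul1r.
Qed.

Lemma comm_tens m n (A : 'M[k]_m.+1) (B : 'M[k]_n.+1) :
  comm_mx (tens_left n A) (tens_right m B).
Proof.
have eAB := tensmx_mul A (1%:M : 'M_n.+1) (1%:M : 'M_m.+1) B.
have eBA := tensmx_mul (1%:M : 'M_m.+1) B A (1%:M : 'M_n.+1).
by apply: etrans eAB _; apply: etrans (esym eBA); rewrite !mulmx1 !mul1mx.
Qed.

End Companion.

(** * Weight spaces *)

Lemma coprime_bezout (k : fieldType) (F G : {poly k}) :
  coprimep F G -> exists u v, u * F + v * G = 1.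
Proof.
case/Bezout_coprimepP=> [[u v] /= /eqpP[[a b] /= /andP[a0 b0] e]].
exists ((b^-1 * a) *: u), ((b^-1 * a) *: v).
by rewrite -!scalerAl -scalerDr -scalerA e scalerA mulVf // scale1r.
Qed.

Section WeightSpaces.
Variables (k : fieldType) (phi : k -> rat).
Hypotheses (phiD : forall x y, phi (x + y) = phi x + phi y).
Variables (V : lmodType k) (T : {linear V -> V}).

(** Working modulo I instead of in the quotient gives all the powers of an ideal
    the same carrier; a weight space for I contains I. *)
Definition weight_space (I : {pred V}) (p : rat) (x : V) : Prop :=
  exists F, weight_poly phi p F /\ act T F x \in I.

Lemma weight_space_sub (I J : {pred V}) p x :
  {subset I <= J} -> weight_space I p x -> weight_space J p x.
Proof. by move=> IJ [F [wF IF]]; exists F; split=> //; apply: IJ. Qed.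

Variable I : {pred V}.
Hypotheses (Iclosed : submod_closed I) (Istable : forall x, x \in I -> T x \in I).

Lemma weight_space_ideal p x : x \in I -> weight_space I p x.
Proof. by exists 1; rewrite act1; split=> //; apply: weight_poly1. Qed.

Lemma weight_space_lin p c x y : weight_space I p x -> weight_space I p y ->
  weight_space I p (c *: x + y).
Proof.
move=> [F [wF Fx]] [G [wG Gy]]; exists (F * G).
split; first exact: weight_polyM.
rewrite linearP /=; apply: (submod_memP Iclosed).
  by rewrite mulrC actM; apply: act_stable.
by rewrite actM; apply: act_stable.
Qed.

(** The polynomials killing f p and the other terms are coprime. *)
Lemma weight_space_independent s (f : rat -> V) : uniq s ->
  (forall p, weight_space I p (f p)) -> \sum_(p <- s) f p \in I ->
  forall p, p \in s -> f p \in I.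
Proof.
move=> us wf If p ps.
have [F [wF Fp]] := wf p.
pose rest (r : seq rat) : V := \sum_(q <- r | q != p) f q.
have [G [cFG Gs]] : exists G, coprimep F G /\ act T G (rest s) \in I.
  elim: s {us If ps} => [|q s [G [cFG Gs]]].
    by exists 1; rewrite coprimep1 /rest big_nil linear0 submod_mem0.
  rewrite /rest big_cons; case: ifPn => qp; last by exists G.
  have [H [wH Hq]] := wf q; exists (H * G); split.
    by rewrite coprimepMr cFG andbT; apply: weight_poly_coprime wF wH; rewrite eq_sym.
  rewrite linearD /=; apply: (submod_memD Iclosed).
    by rewrite mulrC actM; apply: act_stable.
  by rewrite actM; apply: act_stable.
have Gp : act T G (f p) \in I.
  have -> : f p = \sum_(q <- s) f q - rest s.
    by rewrite /rest (bigD1_seq p) //= addrK.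
  by rewrite linearB /=; apply: (submod_memB Iclosed) => //; apply: act_stable.
have [u [v uv]] := coprime_bezout cFG.
rewrite -[f p](act1 T) -uv actD !actM.
by apply: (submod_memD Iclosed); apply: act_stable.
Qed.

(** The primary decomposition, with factors of equal weight put together.  The
    list of weights depends on F only, so that a quotient killed by one F has
    finitely many weights. *)
Lemma weight_space_decomposition (F : {poly k}) : F != 0 ->
  exists s : seq rat, uniq s /\ forall x, act T F x \in I ->
    exists f : rat -> V, (forall p, weight_space I p (f p)) /\
      x - \sum_(p <- s) f p \in I.
Proof.
have [n] := ubnP (size F); elim: n F => // n IHn F ltFn F0.
have [F1|/exists_irreducible_factor [R [mR iR RF]]] := leqP (size F) 1.
  exists [::]; split=> // x Fx; exists (fun=> 0); split=> [p|].
    by apply: weight_space_ideal; apply: submod_mem0.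
  have [c eF] : exists c, F = c%:P by exists F`_0; apply: size1_polyC.
  rewrite big_nil subr0; have c0 : c != 0 by rewrite eF polyC_eq0 in F0.
  have -> : x = c^-1 *: act T F x.
    by rewrite eF -alg_polyC actZ act1 scalerA mulVf // scale1r.
  exact: (submod_memZ Iclosed).
set p := phi (rootsum R) / (size R).-1%:R.
have wR : weight_poly phi p R := weight_poly_irreducible phi mR iR.
have [G [H [eF wG cH]]] := weight_split phi p F0.
have G0 : G != 0 := wG.1.
have H0 : H != 0 by apply: contraNneq F0 => H0; rewrite eF H0 mulr0.
have [|s [us IHs]] := IHn H _ H0.
  rewrite -ltnS; apply: leq_trans ltFn; rewrite ltnS eF size_mul //.
  have RG : R %| G by have := RF; rewrite eF Gauss_dvdpl // cH.
  have := leq_trans iR.1 (dvdp_leq G0 RG).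
  by case: (size G) => [|[|m]] // _; rewrite addSn /= addSn ltnS leq_addl.
have [u [v uv]] := coprime_bezout (cH _ wG).
have split_x x : act T F x \in I -> exists y z,
    [/\ x = y + z, act T H y \in I & weight_space I p z].
  move=> Fx; exists (act T (u * G) x), (act T (v * H) x); split.
  - by rewrite -actD uv act1.
  - by rewrite -actM mulrCA [H * G]mulrC -eF actM; apply: act_stable.
  - exists G; split=> //.
    by rewrite -actM mulrCA -eF actM; apply: act_stable.
case: (boolP (p \in s)) => ps.
  exists s; split=> // x /split_x[y [z [-> /IHs[f [wf If]] wz]]].
  exists (fun q => f q + (if q == p then z else 0)); split=> [q|].
    case: eqP => [->|_]; last by rewrite addr0.
    by rewrite -[f p]scale1r; apply: weight_space_lin.
  have -> : \sum_(q <- s) (f q + (if q == p then z else 0)) =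
      \sum_(q <- s) f q + z.
    rewrite big_split /=; congr (_ + _); rewrite (bigD1_seq p) //= eqxx.
    by rewrite big1 ?addr0 // => q /negPf->.
  by rewrite opprD addrACA subrr addr0.
exists (p :: s); split=> [|x /split_x[y [z [-> /IHs[f [wf If]] wz]]]].
  by rewrite /= ps.
exists (fun q => if q == p then z else f q); split=> [q|].
  by case: eqP => [->|].
rewrite big_cons eqxx (eq_big_seq f) => [|q qs]; last first.
  by case: eqP => // eqp; rewrite -eqp qs in ps.
by rewrite [y + z]addrC opprD addrACA subrr add0r.
Qed.

(** The vectors B (T^i x) (T^j y) span a quotient of the tensor product of two
    cyclic modules, on which T acts by a Kronecker sum of companion matrices
    plus the scalar c. *)
Lemma weight_space_bilinear (B : V -> V -> V) (c : k) p q x y :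
  (forall y, linear (B^~ y)) -> (forall x, linear (B x)) ->
  (forall x y, T (B x y) = c *: B x y + B (T x) y + B x (T y)) ->
  (forall x y, x \in I -> B x y \in I) ->
  (forall x y, y \in I -> B x y \in I) ->
  weight_space I p x -> weight_space I q y ->
  weight_space I (p + q + phi c) (B x y).
Proof.
move=> Bl Br TB BI1 BI2.
(* A killing polynomial of degree zero, whose companion matrix would be empty,
   means that the vector is in I. *)
have monic_poly r z : weight_space I r z -> z \in I \/ exists n F,
    [/\ F \is monic, size F = n.+2, weight_poly phi r F & act T F z \in I].
  move=> [F [wF Fz]].
  have l0 : (lead_coef F)^-1 != 0 by rewrite invr_eq0 lead_coef_eq0 wF.1.
  have eF : (lead_coef F)^-1 *: F %= F by rewrite eqp_scale.
  have mF : (lead_coef F)^-1 *: F \is monic.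
    by rewrite monicE lead_coefZ mulVf // lead_coef_eq0 wF.1.
  case e : (size F) => [|[|n]].
  - by move/eqP: e; rewrite size_poly_eq0 (negPf wF.1).
  - left; rewrite -[z](act1 T).
    have /eqP <- : (lead_coef F)^-1 *: F == 1.
      by rewrite -eqp_monic ?monic1 // -size_poly_eq1 size_scale ?e.
    by rewrite actZ; apply: (submod_memZ Iclosed).
  right; exists n, ((lead_coef F)^-1 *: F); split=> //.
  - by rewrite size_scale.
  - by apply: weight_poly_dvd wF; rewrite (eqp_dvdl _ eF).
  - by rewrite actZ; apply: (submod_memZ Iclosed).
move=> /monic_poly[Ix _|[n [F [mF sF wF Fx]]]].
  by apply: weight_space_ideal; apply: BI1.
move=> /monic_poly[Iy|[m [G [mG sG wG Gy]]]].
  by apply: weight_space_ideal; apply: BI2.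
have orbit r (H : {poly k}) z : H \is monic -> size H = r.+2 -> act T H z \in I ->
    exists M : 'M[k]_r.+1, horner_mx M H = 0 /\ forall i : 'I_r.+1,
      T (iter i T z) - \sum_j M i j *: iter j T z \in I.
  move=> mH sH Hz; have [M [MH eM]] := companion_matrix mH sH.
  exists M; split=> // i.
  under eq_bigr do rewrite eM; case: (ltngtP i r) => [lti|lti|ei].
  - rewrite (bigD1 (Ordinal (lti : (i.+1 < r.+1)%N))) //= eqxx scale1r.
    rewrite big1 ?addr0 ?subrr ?(submod_mem0 Iclosed) // => j.
    rewrite -val_eqE /= eq_sym => /negPf ->.
    by rewrite scale0r.
  - by have := ltn_ord i; rewrite ltnS leqNgt lti.
  have -> : T (iter i T z) - \sum_(j < r.+1) - H`_j *: iter j T z = act T H z.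
    rewrite /act sH [RHS]big_ord_recr /= [RHS]addrC; congr (_ + _).
      by move/monicP: mH; rewrite lead_coefE sH /= => ->; rewrite scale1r ei.
    by rewrite -sumrN; apply: eq_bigr => j _; rewrite scaleNr opprK.
  by [].
have [M [MF xM]] := orbit _ _ _ mF sF Fx.
have [N [NG yN]] := orbit _ _ _ mG sG Gy.
pose A := tens_left m M; pose D := tens_right n N.
pose idx (u : 'I_(m + n * m.+1).+1) := mxtens_unindex (u : 'I_(n.+1 * m.+1)).
pose Z u := B (iter (idx u).1 T x) (iter (idx u).2 T y).
exists (mxminpoly (A + D + c%:M)); split.
  apply: weight_mxminpoly_add wF wG _ _ _ => //.
  - by rewrite horner_tens_left MF /tens_left tens0mx.
  - by rewrite horner_tens_right NG /tens_right tensmx0.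
  - exact: comm_tens.
have -> : B x y = Z (mxtens_index (ord0, ord0) : 'I_(n.+1 * m.+1)).
  by rewrite /Z /idx mxtens_indexK.
apply: (act_family Iclosed Istable (M := A + D + c%:M)); last first.
  exact: mx_root_minpoly.
move=> u.
have ZB w : Z (mxtens_index w : 'I_(n.+1 * m.+1)) = B (iter w.1 T x) (iter w.2 T y).
  by rewrite /Z /idx mxtens_indexK.
rewrite -[u](@mxtens_unindexK n.+1 m.+1); case: (mxtens_unindex _) => i j.
set r : V := \sum_w _.
have -> : r = \sum_i' M i i' *: B (iter i' T x) (iter j T y)
    + \sum_j' N j j' *: B (iter i T x) (iter j' T y)
    + c *: B (iter i T x) (iter j T y).
  rewrite /r (reindex (@mxtens_index n.+1 m.+1)) /=; last first.
    exists (@mxtens_unindex n.+1 m.+1) => w _.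
      exact: mxtens_indexK.
    exact: mxtens_unindexK.
  have entry w : (A + D + c%:M) (mxtens_index (i, j) : 'I_(n.+1 * m.+1))
      (mxtens_index w : 'I_(n.+1 * m.+1)) =
    M i w.1 * (j == w.2)%:R + (i == w.1)%:R * N j w.2
    + c * ((i == w.1)%:R * (j == w.2)%:R).
    case: w => i' j' /=.
    rewrite [LHS]mxE [in LHS]mxE; congr (_ + _ + _).
    - by apply: etrans (tensmxE M (1%:M : 'M_m.+1) i j i' j') _; rewrite mxE.
    - by apply: etrans (tensmxE (1%:M : 'M_n.+1) N i j i' j') _; rewrite mxE.
    rewrite [LHS](_ : _ = (c%:M : 'M_(n.+1 * m.+1))
      (mxtens_index (i, j)) (mxtens_index (i', j'))) //.
    by rewrite tensmx_scalar tensmxE !mxE -[c *+ _]mulr_natr mulrA.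
  under eq_bigr do rewrite entry ZB !scalerDl.
  rewrite !big_split /=; congr (_ + _ + _).
  - rewrite -(pair_bigA _ (fun i' j' => (M i i' * (j == j')%:R) *:
      B (iter i' T x) (iter j' T y))) /=.
    apply: eq_bigr => i' _; rewrite (bigD1 j) //= eqxx mulr1 big1 ?addr0 // => j'.
    by rewrite eq_sym => /negPf->; rewrite mulr0 scale0r.
  - rewrite -(pair_bigA _ (fun i' j' => ((i == i')%:R * N j j') *:
      B (iter i' T x) (iter j' T y))) exchange_big /=.
    apply: eq_bigr => j' _; rewrite (bigD1 i) //= eqxx mul1r big1 ?addr0 // => i'.
    by rewrite eq_sym => /negPf->; rewrite mul0r scale0r.
  rewrite (bigD1 (i, j)) //= !eqxx !mulr1 big1 ?addr0 // => -[i' j'].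
  rewrite xpair_eqE eq_sym [j' == j]eq_sym /= => /nandP[]/negPf->.
    by rewrite mul0r mulr0 scale0r.
  by rewrite !mulr0 scale0r.
have lin_comb (f : V -> V) : linear f -> forall d (v : 'I_d -> V) (a : 'I_d -> k) z,
    f (z - \sum_l a l *: v l) = f z - \sum_l a l *: f (v l).
  move=> lf d v a z.
  have fB z1 z2 : f (z1 - z2) = f z1 - f z2.
    by rewrite addrC -scaleN1r lf scaleN1r addrC.
  rewrite fB; congr (_ - _); elim/big_rec2: _ => [|l z1 z2 _ <-]; last by rewrite lf.
  by have := fB 0 0; rewrite !subrr.
have := submod_memD Iclosed (BI1 _ (iter j T y) (xM i)) (BI2 (iter i T x) _ (yN j)).
rewrite (lin_comb _ (Bl _)) (lin_comb _ (Br _)) ZB TB /=.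
set cb := c *: _; set a1 := B (T _) _; set a2 := B _ (T _).
set s1 := \sum_l _; set s2 := \sum_l _.
suff -> : a1 - s1 + (a2 - s2) = cb + a1 + a2 - (s1 + s2 + cb) by [].
by rewrite -[cb + a1 + a2]addrA [cb + _]addrC opprD [RHS]addrACA subrr addr0 opprD
  [RHS]addrACA.
Qed.

End WeightSpaces.

(** * Powers of an ideal and their quotients *)

Section PowersOfIdeal.
Variables (A : comNzRingType) (m : idealr A).

Lemma ideal_pow_ideal q : ideal (ideal_pow m q).
Proof.
case: q => [|q]; first by split.
by have [m0 _ mL] := ideal_pow_closed m q; split.
Qed.

Lemma ideal_pow0 q : 0 \in ideal_pow m q.
Proof. exact: submod_mem0 (ideal_pow_ideal q). Qed.

Lemma ideal_powD q x y :
  x \in ideal_pow m q -> y \in ideal_pow m q -> x + y \in ideal_pow m q.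
Proof. exact: (submod_memD (ideal_pow_ideal q)). Qed.

Lemma ideal_powMl q a x : x \in ideal_pow m q -> a * x \in ideal_pow m q.
Proof. exact: (submod_memZ (ideal_pow_ideal q)). Qed.

Lemma ideal_powB q x y :
  x \in ideal_pow m q -> y \in ideal_pow m q -> x - y \in ideal_pow m q.
Proof. exact: (submod_memB (ideal_pow_ideal q)). Qed.

Lemma ideal_pow_sum q (J : Type) (r : seq J) (P : pred J) (f : J -> A) :
  (forall j, P j -> f j \in ideal_pow m q) ->
  \sum_(j <- r | P j) f j \in ideal_pow m q.
Proof. exact: (submod_mem_sum (ideal_pow_ideal q)). Qed.

Lemma ideal_powSM q x y :
  x \in m -> y \in ideal_pow m q -> x * y \in ideal_pow m q.+1.
Proof.
move=> mx my; apply/asboolP; exists [:: (x, y)]; split; last by rewrite big_seq1.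
by move=> u; rewrite inE => /eqP->.
Qed.

Lemma ideal_powS_ind (P : A -> Prop) q :
  (forall x y, P x -> P y -> P (x + y)) -> P 0 ->
  (forall x y, x \in m -> y \in ideal_pow m q -> P (x * y)) ->
  forall x, x \in ideal_pow m q.+1 -> P x.
Proof.
move=> PD P0 PM x /asboolP[s [ms ->]]; rewrite big_seq.
by elim/big_ind: _ => // u /ms[]; apply: PM.
Qed.

Lemma ideal_powM i j x y :
  x \in ideal_pow m i -> y \in ideal_pow m j -> x * y \in ideal_pow m (i + j).
Proof.
move=> mx my; elim: i x mx => [|i IHi] x; first by move=> _; apply: ideal_powMl.
move: x; apply: ideal_powS_ind => [x z mx mz||x z mx mz].
- by rewrite mulrDl; apply: ideal_powD.
- by rewrite mul0r ideal_pow0.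
by rewrite -mulrA addSn; apply: ideal_powSM => //; apply: IHi.
Qed.

Lemma ideal_pow1 x : (x \in ideal_pow m 1) = (x \in m).
Proof.
apply/idP/idP => [|mx]; last by rewrite -[x]mulr1; apply: ideal_powSM.
move: x; apply: ideal_powS_ind => [x y||x y mx _].
- exact: rpredD.
- exact: rpred0.
by rewrite mulrC; apply: idealMr.
Qed.

Lemma ideal_pow_le i j : (i <= j)%N -> {subset ideal_pow m j <= ideal_pow m i}.
Proof.
move=> /subnK <-; elim: (j - i)%N => // d IHd x; rewrite addSn => /ideal_powS.
exact: IHd.
Qed.

End PowersOfIdeal.

Section Derivations.
Variables (k : fieldType) (A : comAlgType k) (m : idealr A).

Lemma ideal_pow_submod q : submod_closed (ideal_pow m q : {pred A}).
Proof.
split=> [|c x y mx my]; first exact: ideal_pow0.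
by rewrite -mulr_algl; apply: ideal_powD => //; apply: ideal_powMl.
Qed.

Lemma derivation_ideal_pow (D : {linear A -> A}) q :
  derivation D -> (forall a, a \in m -> D a \in m) ->
  forall a, a \in ideal_pow m q -> D a \in ideal_pow m q.
Proof.
move=> Dder Dm; elim: q => // q IHq; apply: ideal_powS_ind => [x y||x y mx my].
- by rewrite linearD; apply: ideal_powD.
- by rewrite linear0 ideal_pow0.
by rewrite Dder; apply: ideal_powD; apply: ideal_powSM => //; [exact: Dm|exact: IHq].
Qed.

Hypotheses (A_noetherian : noetherian A) (A_residue : residue_field_is_base m).

Lemma residue_decomposition (a : A) : exists c : k, a - c%:A \in m.
Proof.
have [g _ pig] := A_residue; exists (g (\pi_{ideal_quot m}%qT a)).
by rewrite Quotient.idealrBE; apply/eqP; rewrite pig.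
Qed.

(** Modulo m^(q+1), the coefficients of the generators of m^q matter only in
    the residue field. *)
Lemma jet_finite q : exists n (v : 'I_n -> A), (0 < n)%N /\
  forall x, exists c : 'I_n -> k, x - \sum_i c i *: v i \in ideal_pow m q.
Proof.
elim: q => [|q [n [v [n0 IHv]]]].
  by exists 1%N, (fun=> 0); split=> // x; exists (fun=> 0).
have [s gs] := A_noetherian (ideal_pow_ideal m q).
exists (n + size s)%N, (fun i : 'I_(n + size s) =>
  match split i with inl j => v j | inr j => s`_j end).
split=> [|x]; first by rewrite addn_gt0 n0.
have [c xc] := IHv x; have /gs[d xd] := xc.
have [t mt] := choice (fun j => residue_decomposition (d j)).
exists (fun i : 'I_(n + size s) =>
  match split i with inl j => c j | inr j => t j end).
rewrite big_split_ord /=.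
under eq_bigr do rewrite (unsplitK (inl _)).
under [X in _ - (_ + X)]eq_bigr do rewrite (unsplitK (inr _)).
rewrite opprD addrA xd -sumrB.
apply: (ideal_pow_sum (q := q.+1)) => j _.
rewrite -mulr_algl -mulrBl; apply: ideal_powSM; first exact: mt.
apply/gs; exists (fun i => (i == j)%:R).
rewrite (bigD1 j) //= eqxx mul1r big1 ?addr0 // => i /negPf->.
by rewrite mul0r.
Qed.

(** The Cayley-Hamilton theorem for a spanning family. *)
Lemma jet_annihilator (T : {linear A -> A}) q :
  (forall a, a \in ideal_pow m q -> T a \in ideal_pow m q) ->
  exists F : {poly k}, F != 0 /\ forall x, act T F x \in ideal_pow m q.
Proof.
move=> Tm; have [[|n] [v [// _ span]]] := jet_finite q.
have [M vM] := choice (fun i => span (T (v i))).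
pose N := \matrix_(i, j) M i j.
have Nv i : act T (char_poly N) (v i) \in ideal_pow m q.
  apply: (act_family (ideal_pow_submod q) Tm (M := N)).
    by move=> j; under eq_bigr do rewrite mxE; apply: vM.
  exact: Cayley_Hamilton.
exists (char_poly N); split=> [|x]; first by rewrite monic_neq0 ?char_poly_monic.
have [c xc] := span x; rewrite -[x](subrK (\sum_i c i *: v i)) linearD.
apply: ideal_powD; first exact: (act_stable (ideal_pow_submod q)).
rewrite linear_sum; apply: ideal_pow_sum => i _; rewrite linearZ /=.
exact: (submod_memZ (ideal_pow_submod q)).
Qed.

End Derivations.

(** * Weights with a common denominator *)

Lemma common_denominator (s : seq rat) : exists N : nat, (0 < N)%N /\
  forall p, p \in s -> exists z : int, p = z%:~R / N%:R.
Proof.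
elim: s => [|r s [N [N0 sN]]]; first by exists 1%N.
have Nr0 : (N%:R : rat) != 0 by rewrite pnatr_eq0 -lt0n.
have d0 : ((`|denq r|%N)%:R : rat) != 0 by rewrite pnatr_eq0 absz_eq0 denq_neq0.
have dr : (`|denq r|%N)%:R = (denq r)%:~R :> rat.
  by rewrite -{2}[denq r]gez0_abs // denq_ge0.
exists (N * `|denq r|)%N; split; first by rewrite muln_gt0 N0 absz_gt0 denq_neq0.
move=> p; rewrite inE => /predU1P[->|/sN[z ->]].
  exists (numq r * N); rewrite natrM intrM invfM mulrA mulfK // dr.
  exact/esym/divq_num_den.
by exists (z * `|denq r|%N); rewrite natrM intrM invfM mulrA mulrAC mulfK.
Qed.

Section Integrality.
Variables (k : fieldType) (phi : k -> rat).
Hypotheses (phiD : forall x y, phi (x + y) = phi x + phi y).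
Variables (A : comAlgType k) (m : idealr A) (xi : {linear A -> A}).
Hypotheses (xi_der : derivation xi) (xi_m : forall a, a \in m -> xi a \in m).
Hypotheses (A_noetherian : noetherian A) (A_residue : residue_field_is_base m).

Local Notation W q := (weight_space phi xi (ideal_pow m q)).

Let Mclosed q : submod_closed (ideal_pow m q : {pred A}) := ideal_pow_submod m q.
Let Mstable q x : x \in ideal_pow m q -> xi x \in ideal_pow m q.
Proof. exact: derivation_ideal_pow. Qed.

Lemma weight_space_congr q p a b : a - b \in ideal_pow m q -> W q p a -> W q p b.
Proof.
move=> ab wa; rewrite -[b](subKr a) addrC -scaleN1r.
by apply: (weight_space_lin (Mclosed q) (@Mstable q)) => //; apply: weight_space_ideal.
Qed.

Lemma weight_spaceM q p r a b : W q p a -> W q r b -> W q (p + r) (a * b).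
Proof.
move=> wa wb; rewrite -[p + r]addr0 -(phi0 phiD).
apply: (weight_space_bilinear phiD (Mclosed q) (@Mstable q) (B := *%R)) wa wb.
- by move=> y c x z; rewrite mulrDl scalerAl.
- by move=> x c y z; rewrite mulrDr scalerAr.
- by move=> x y; rewrite scale0r add0r xi_der.
- by move=> x y mx; rewrite mulrC; apply: ideal_powMl.
- by move=> x y; apply: ideal_powMl.
Qed.

Lemma rational_decomposition q : exists s : seq rat, uniq s /\ forall x,
  exists f : rat -> A, (forall p, W q p (f p)) /\
    x - \sum_(p <- s) f p \in ideal_pow m q.
Proof.
have [F [F0 FA]] := jet_annihilator A_noetherian A_residue (@Mstable q).
have [s [us sx]] := weight_space_decomposition phi (Mclosed q) (@Mstable q) F0.
by exists s; split=> // x; apply: sx.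
Qed.

Section Denominator.
Variable N : nat.
Hypothesis W2N : forall x, exists (s : seq rat) (f : rat -> A),
  [/\ uniq s, forall p, p \in s -> exists z : int, p = z%:~R / N%:R,
      forall p, W 2 p (f p) & x - \sum_(p <- s) f p \in ideal_pow m 2].

(** A list, in which weights may repeat, is easier to add and multiply than a
    family indexed by the weights. *)
Definition integral_sum q (x : A) : Prop := exists l : seq (int * A),
  (forall u, u \in l -> W q (u.1%:~R / N%:R) u.2) /\
  x - \sum_(u <- l) u.2 \in ideal_pow m q.

Lemma integral_sum_ideal q x : x \in ideal_pow m q -> integral_sum q x.
Proof. by exists [::]; rewrite big_nil subr0. Qed.

Lemma integral_sum_weight q z x : W q (z%:~R / N%:R) x -> integral_sum q x.
Proof.
move=> wx; exists [:: (z, x)]; rewrite big_seq1 subrr ideal_pow0; split=> //.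
by move=> u; rewrite inE => /eqP->.
Qed.

Lemma integral_sumD q x y : integral_sum q x -> integral_sum q y ->
  integral_sum q (x + y).
Proof.
move=> [l [wl xl]] [l' [wl' yl']]; exists (l ++ l'); split.
  by move=> u; rewrite mem_cat => /orP[/wl|/wl'].
by rewrite big_cat /= opprD addrACA; apply: ideal_powD.
Qed.

Lemma integral_sum_big q (J : eqType) (r : seq J) (P : pred J) (f : J -> A) :
  (forall j, j \in r -> P j -> integral_sum q (f j)) ->
  integral_sum q (\sum_(j <- r | P j) f j).
Proof.
move=> rf; rewrite big_seq_cond; elim/big_ind: _ => [||j /andP[]].
- exact/integral_sum_ideal/ideal_pow0.
- exact: integral_sumD.
- exact: rf.
Qed.

Lemma integral_sumM q x y : integral_sum q x -> integral_sum q y ->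
  integral_sum q (x * y).
Proof.
move=> [l [wl xl]] [l' [wl' yl']].
rewrite -[x](subrK (\sum_(u <- l) u.2)) mulrDl; apply: integral_sumD.
  by apply: integral_sum_ideal; rewrite mulrC; apply: ideal_powMl.
rewrite -[y](subrK (\sum_(u <- l') u.2)) mulrDr; apply: integral_sumD.
  by apply: integral_sum_ideal; apply: ideal_powMl.
rewrite mulr_suml; apply: integral_sum_big => u lu _.
rewrite mulr_sumr; apply: integral_sum_big => v lv _.
apply: (@integral_sum_weight q (u.1 + v.1)).
by rewrite intrD mulrDl; apply: weight_spaceM; [apply: wl|apply: wl'].
Qed.

(** Of the rational decomposition of x modulo m^(q+2), the parts of weight
    outside (1/N)Z lie in m^2, because A/m^2 has no such weights. *)
Lemma integral_sum_mod2 q x : exists y, integral_sum q.+2 y /\ x - y \in ideal_pow m 2.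
Proof.
have [s [us /(_ x)[f [wf xf]]]] := rational_decomposition q.+2.
have le2 : {subset ideal_pow m q.+2 <= ideal_pow m 2} by apply: ideal_pow_le.
pose int_weight p := `[< exists z : int, p = z%:~R / N%:R :> rat >].
exists (\sum_(p <- s | int_weight p) f p); split.
  apply: integral_sum_big => p _ /asboolP[z ez].
  by apply: (@integral_sum_weight _ z); rewrite -ez.
rewrite -[x](subrK (\sum_(p <- s) f p)) -addrA; apply: ideal_powD; first exact: le2.
rewrite [X in X - _](bigID int_weight) /= addrAC subrr add0r.
apply: (ideal_pow_sum (q := 2)) => p /asboolPn np.
have w2p : W 2 p (f p) := weight_space_sub le2 (wf p).
have [t [g [ut tN wg fg]]] := W2N (f p).
have pt : p \notin t by apply/negP => /tN.
pose h r := if r == p then f p else - g r.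
have -> : f p = h p by rewrite /h eqxx.
apply: (weight_space_independent (phi := phi) (Mclosed 2) (@Mstable 2)
  (s := p :: t) (f := h)).
- by rewrite /= pt.
- move=> r; rewrite /h; case: eqP => [->//|_].
  rewrite -scaleN1r -[_ *: _]addr0.
  by apply: (weight_space_lin (Mclosed 2) (@Mstable 2)) => //;
    apply: weight_space_ideal; rewrite ideal_pow0.
- rewrite big_cons {1}/h eqxx (eq_big_seq (fun r => - g r)) ?sumrN // => r tr.
  by rewrite /h; case: eqP => // rp; rewrite -rp tr in pt.
- exact: mem_head.
Qed.

(** Both factors of a product in m * m^(j+1) can be approximated by elements of
    the subalgebra, with an error in the next power. *)
Lemma integral_sum_step q j x : x \in ideal_pow m j.+1 ->
  exists y, integral_sum q.+2 y /\ x - y \in ideal_pow m j.+2.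
Proof.
elim: j x => [|j IHj] x; first by move=> _; apply: integral_sum_mod2.
move: x; apply: ideal_powS_ind => [x x' [y [Sy xy]] [y' [Sy' xy']]||u v mu mv].
- exists (y + y'); split; first exact: integral_sumD.
  by rewrite opprD addrACA; apply: ideal_powD.
- by exists 0; split; [apply/integral_sum_ideal/ideal_pow0|rewrite subrr ideal_pow0].
have [y [Sy uy]] := integral_sum_mod2 q u; have [z [Sz vz]] := IHj v mv.
exists (y * z); split; first exact: integral_sumM.
have -> : u * v - y * z = (u - y) * v + y * (v - z).
  by rewrite mulrBl mulrBr addrA subrK.
apply: ideal_powD; first by have := ideal_powM uy mv.
apply: ideal_powSM => //; rewrite -[y](subKr u); apply: rpredB => //.
by rewrite -ideal_pow1; apply: ideal_powS.
Qed.

(** The error of approximation starts in m^2 and is pushed down to m^(q+2). *)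
Lemma integral_decomposition q x : integral_sum q.+1 x.
Proof.
have S2 r : integral_sum r.+2 x.
  have approx j : exists y, integral_sum r.+2 y /\ x - y \in ideal_pow m j.+2.
    elim: j => [|j [y [Sy xy]]]; first exact: integral_sum_mod2.
    have [z [Sz xz]] := integral_sum_step r xy.
    exists (y + z); split; first exact: integral_sumD.
    by rewrite opprD addrA.
  have [y [Sy xy]] := approx r.
  rewrite -[x](subrK y); apply: integral_sumD => //.
  exact: integral_sum_ideal.
have [l [wl xl]] := S2 q; exists l; split.
  by move=> u /wl; apply: weight_space_sub; apply: ideal_powS.
exact: ideal_powS.
Qed.

End Denominator.

Lemma uniform_denominator : exists N : nat, (0 < N)%N /\
  forall q x, integral_sum N q.+1 x.
Proof.
have [s [us sx]] := rational_decomposition 2.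
have [N [N0 sN]] := common_denominator s.
exists N; split=> // q x; apply: integral_decomposition => y.
by have [f [wf yf]] := sx y; exists s, f.
Qed.

End Integrality.

(** * The grading on the jets *)

Section Jets.
Variables (k : fieldType) (A : comAlgType k) (m : idealr A).

Lemma to_jet_linear q c (a b : A) :
  to_jet m q (c *: a + b) = c *: to_jet m q a + to_jet m q b.
Proof.
rewrite /to_jet [LHS]Quotient.pi_add; congr (_ + _).
exact/esym/quot_scale_pi.
Qed.

HB.instance Definition _ q := GRing.isLinear.Build k A (jet m q) *:%R
  (to_jet m q) (@to_jet_linear q).

Lemma to_jetM q (a b : A) : to_jet m q (a * b) = to_jet m q a * to_jet m q b.
Proof. exact: Quotient.pi_mul. Qed.

Lemma to_jet_eq0 q (a : A) : to_jet m q a = 0 <-> a \in ideal_pow m q.+1.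
Proof.
have -> : (a \in ideal_pow m q.+1) = (to_jet m q a == to_jet m q 0).
  by rewrite -Quotient.idealrBE subr0.
have -> : to_jet m q 0 = 0.
  apply: (addrI (to_jet m q 0)); rewrite addr0.
  by have := to_jet_linear q 1 0 0; rewrite scaler0 scale1r addr0.
by split => /eqP.
Qed.

Lemma repr_to_jet q (a : A) : repr (to_jet m q a) - a \in ideal_pow m q.+1.
Proof. by rewrite Quotient.idealrBE; apply/eqP; exact: reprK. Qed.

End Jets.

Theorem proposition4p1 (k : fieldType) (chark0 : [pchar k] =i pred0)
    (A : comAlgType k) (br : {bilinear A -> A -> A})
    (br_poisson : poisson br) (br_exact : exact_poisson br)
    (m : idealr A)
    (A_noetherian : noetherian A) (A_local : local_with m)
    (A_residue : residue_field_is_base m) (A_complete : complete m)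
    (m_stable : forall D : {linear A -> A}, derivation D ->
       forall a, a \in m -> D a \in m) :
  exists (l : int) (gr : forall q, int -> {pred jet m q}),
    [/\ l != 0, completed_grading gr
      & forall (p q : int) (a b : A), degree_part gr p a ->
          degree_part gr q b -> degree_part gr (p + q - l) (br a b)].
Proof.
have [phi [phiD phi1]] := exists_functional chark0.
have [xi [xi_der xi_br]] := br_exact.
have xi_m := m_stable xi xi_der.
have Mstable q := derivation_ideal_pow (q := q) xi_der xi_m.
have [N [N0 intA]] := uniform_denominator phiD xi_der xi_m A_noetherian A_residue.
have Nr0 : (N%:R : rat) != 0 by rewrite pnatr_eq0 -lt0n.
pose W q p a := weight_space phi xi (ideal_pow m q.+1) (p%:~R / N%:R) a.
pose gr q p : {pred jet m q} := fun x => `[< W q p (repr x) >].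
have grP q p a : to_jet m q a \in gr q p <-> W q p a.
  have aa := repr_to_jet m q a.
  split=> [/asboolP|wa]; first exact: weight_space_congr.
  apply/asboolP; apply: weight_space_congr wa => //.
  by rewrite -opprB -sub0r ideal_powB ?ideal_pow0.
have jetP q (x : jet m q) : to_jet m q (repr x) = x by exact: reprK.
have br_der a : derivation (br a).
  by move=> b c; rewrite /= (poisson_leibniz br_poisson) [b * _]mulrC.
have brM2 q a b : b \in ideal_pow m q -> br a b \in ideal_pow m q.
  exact: (derivation_ideal_pow (br_der a) (m_stable _ (br_der a))) b.
(* The bracket adds phi 1 = 1 to the rational weights, hence N to the integral
   ones. *)
exists (- N%:Z), gr; split.
- by rewrite oppr_eq0 -lt0n.
- split.
  + move=> q; split.
    * move=> p; split=> [|c x y].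
        have -> : 0 = to_jet m q 0 by apply/esym/to_jet_eq0/ideal_pow0.
        by apply/grP/weight_space_ideal/ideal_pow0.
      rewrite -[x]jetP -[y]jetP => /grP wx /grP wy.
      rewrite -to_jet_linear; apply/grP.
      exact: (weight_space_lin (ideal_pow_submod _ _) (@Mstable _)).
    * move=> x; have [l [wl xl]] := intA q (repr x).
      pose part p := \sum_(u <- l | u.1 == p) u.2.
      exists (undup [seq u.1 | u <- l]), (fun p => to_jet m q (part p)); split.
      - exact: undup_uniq.
      - move=> p; apply/grP; rewrite /part big_seq_cond.
        elim/big_ind: _ => [|a b wa wb|u /andP[/wl wu /eqP<-]] //.
          by apply/weight_space_ideal/ideal_pow0.
        rewrite -[a]scale1r.
        exact: (weight_space_lin (ideal_pow_submod _ _) (@Mstable _)).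
      rewrite -[LHS]jetP -linear_sum; apply/eqP; rewrite -subr_eq0 -linearB; apply/eqP.
      apply/to_jet_eq0; rewrite /part (exchange_big_dep xpredT) //=.
      rewrite (eq_big_seq (fun u => u.2)) // => u ul.
      rewrite big_mkcond (bigD1_seq u.1) ?undup_uniq ?mem_undup ?map_f //= eqxx.
      by rewrite big1 ?addr0 // => p; rewrite eq_sym => /negPf->.
    * move=> s f us fgr f0 p ps.
      pose scaled z : rat := z%:~R / N%:R.
      have scaledK z : numq (scaled z * N%:R) = z by rewrite /scaled divfK // numq_int.
      (* the family f reindexed by rational weights, and extended by zero *)
      pose g r : A := if r \in [seq scaled z | z <- s]
        then repr (f (numq (r * N%:R))) else 0.
      have gE z : z \in s -> g (scaled z) = repr (f z).
        by move=> zs; rewrite /g map_f // scaledK.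
      rewrite -[f p]jetP -gE //; apply/to_jet_eq0.
      apply: (weight_space_independent (phi := phi) (ideal_pow_submod _ _)
        (@Mstable _) (s := [seq scaled z | z <- s])).
      - by rewrite map_inj_uniq //; apply: (can_inj (g := fun r => numq (r * N%:R))).
      - move=> r; rewrite /g; case: ifP => [/mapP[z zs ->]|_].
          by rewrite scaledK; apply/asboolP/fgr.
        by apply/weight_space_ideal/ideal_pow0.
      - apply/to_jet_eq0; rewrite big_map linear_sum -[RHS]f0.
        by apply: eq_big_seq => z zs; rewrite /= gE // jetP.
      - exact: map_f.
  + move=> q p p' x y; rewrite -[x]jetP -[y]jetP => /grP wx /grP wy.
    rewrite -to_jetM; apply/grP; rewrite /W intrD mulrDl.
    exact: weight_spaceM.
  + move=> q p x; rewrite -[x]jetP => /grP wx; rewrite jet_proj_to_jet; apply/grP.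
    by apply: weight_space_sub wx => a; apply: ideal_powS.
move=> p q a b wa wb r; apply/grP.
have -> : W r (p + q - - N%:Z) (br a b) = weight_space phi xi (ideal_pow m r.+1)
    (p%:~R / N%:R + q%:~R / N%:R + phi 1) (br a b).
  by rewrite /W phi1 opprK !intrD !mulrDl -pmulrn divff.
apply: (weight_space_bilinear phiD (ideal_pow_submod _ _) (@Mstable _)).
- by move=> y c x z; rewrite linearPl.
- by move=> x c y z; rewrite linearPr.
- by move=> x y; rewrite scale1r xi_br.
- move=> x y mx; rewrite (poisson_skew br_poisson) -sub0r.
  by apply: ideal_powB; [exact: ideal_pow0|exact: brM2].
- by move=> x y; apply: brM2.
- exact/grP.
- exact/grP.
Qed.
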